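(* Let the data $(\sigma_i,b_i,h_i,\mathbb{S}_i,\chi_i)_{1\le i\le I}$, $h_0$ and the constants $\lambda,R>0$ be as in the context, and suppose that assumptions (S), (E) and (R) of the context hold. Then the comparison theorem for continuous viscosity solutions holds for the following system posed on the star-shaped network $\mathcal{N}_R$: $$\begin{cases} \lambda w_i(x)+\sup_{\beta_i\in\mathcal{B}_i}\big\{-\sigma_i(x,\beta_i)\partial_x^2w_i(x)+b_i(x,\beta_i)\partial_xw_i(x)+h_i(x,\beta_i)\big\}=0, & x\in(0,R),\ 1\le i\le I,\\ \inf_{\vartheta\in\mathcal{O}}\big\{\sum_{i=1}^I\mathbb{S}_i(\vartheta)\partial_xw_i(0)+h_0(\vartheta)\big\}=0,\\ w_i(R)=\chi_i, & 1\le i\le I,\\ w_i(0)=w_j(0), & 1\le i,j\le I. \end{cases}$$ That is: if $v\in\mathcal{C}(\mathcal{N}_R)$ is a continuous viscosity sub solution and $u\in\mathcal{C}(\mathcal{N}_R)$ is a continuous viscosity super solution of this system, in the sense defined in the context, and if $u_i(R)\ge v_i(R)$ for all $i\in\{1,\dots,I\}$, then $$\forall(x,i)\in[0,R]\times\{1,\dots,I\},\quad u_i(x)\ge v_i(x).$$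
   Context: **Network.** Fix $I\in\mathbb{N}$, $I\ge1$, and real numbers $R>0$, $\lambda>0$. The star-shaped network $\mathcal{N}_R=\bigcup_{i=1}^I\mathcal{R}_i$ is the union of $I$ rays $\mathcal{R}_i\cong[0,R]$ glued at their common endpoint $0$ (the junction point, or vertex, $\mathbf{0}$), distinct rays meeting only at $\mathbf{0}$. Points are written $(x,i)$ with $x\in[0,R]$, $i\in\{1,\dots,I\}$, and $(0,i)=(0,j)=\mathbf{0}$ for all $i,j$. $\mathcal{N}_R$ carries the geodesic metric, so a neighborhood of $\mathbf{0}$ contains a piece of every ray. **Function spaces.** $\mathcal{C}(\mathcal{N}_R)$ is the set of functions $f:(x,i)\mapsto f_i(x)\in\mathbb{R}$ such that every $f_i$ is continuous on $[0,R]$ and $f_i(0)=f_j(0)=:f(0)$ for all $i,j$. $\mathcal{C}^2(\mathcal{N}_R)$ is the set of $f\in\mathcal{C}(\mathcal{N}_R)$ with every $f_i\in\mathcal{C}^2([0,R])$ (no relation is imposed between derivatives of different $f_i$ at $0$). **Data.** $\mathcal{B}_1,\dots,\mathcal{B}_I$ are nonempty compact subsets of $\mathbb{R}$ and $\mathcal{O}$ is a nonempty compact subset of $\mathbb{R}^I$. For each $i$, $\sigma_i,b_i,h_i:[0,R]\times\mathcal{B}_i\to\mathbb{R}$, $\mathbb{S}_i:\mathcal{O}\to\mathbb{R}$ and $h_0:\mathcal{O}\to\mathbb{R}$ are continuous, and $\chi_i\in\mathbb{R}$. **Assumptions.** (S) There is $\underline{\zeta}>0$ with $\mathbb{S}_i(\vartheta)\ge\underline{\zeta}$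 for all $i$ and all $\vartheta\in\mathcal{O}$. (E) There is $\underline{\sigma}>0$ with $\sigma_i(x,\beta_i)\ge\underline{\sigma}$ for all $i$ and all $(x,\beta_i)\in[0,R]\times\mathcal{B}_i$. (R) There are constants $|b|,|h|,\overline{\zeta},\overline{\sigma}\in(0,+\infty)$ such that, for every $i$: for each of the pairs $(F,C)=(b_i,|b|)$, $(\sigma_i,\overline{\sigma})$, $(h_i,|h|)$, $$\sup_{x,\beta_i}|F(x,\beta_i)|+\sup_{\beta_i}\sup_{x\ne y}\frac{|F(x,\beta_i)-F(y,\beta_i)|}{|x-y|}\le C,$$ and $\sup_{\vartheta}|\mathbb{S}_i(\vartheta)|\le\overline{\zeta}$, $\sup_{\vartheta}|h_0(\vartheta)|\le|h|$. **Viscosity super/sub solutions.** A function $u\in\mathcal{C}(\mathcal{N}_R)$ is a continuous viscosity super solution of the system if for every $\phi\in\mathcal{C}^2(\mathcal{N}_R)$ and every local minimum point $(x_\star,i_\star)\in[0,R]\times\{1,\dots,I\}$ of $u-\phi$ with $(u-\phi)_{i_\star}(x_\star)=0$: - if $x_\star\in(0,R)$, then $\lambda\phi_{i_\star}(x_\star)+\sup_{\beta\in\mathcal{B}_{i_\star}}\{-\sigma_{i_\star}(x_\star,\beta)\partial_x^2\phi_{i_\star}(x_\star)+b_{i_\star}(x_\star,\beta)\partial_x\phi_{i_\star}(x_\star)+h_{i_\star}(x_\star,\beta)\}\ge0$; - if $x_\star=0$, then $\inf_{\vartheta\in\mathcal{O}}\{\sum_{i=1}^I\mathbb{S}_i(\vartheta)\partial_x\phi_i(0)+h_0(\vartheta)\}\le0$.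 A function $v\in\mathcal{C}(\mathcal{N}_R)$ is a continuous viscosity sub solution if for every such $\phi$ and every local maximum point $(x_\star,i_\star)$ of $v-\phi$ with $(v-\phi)_{i_\star}(x_\star)=0$, the same two conditions hold with the inequalities reversed ($\le0$ in the first, $\ge0$ in the second). Local extrema are taken in $\mathcal{N}_R$. The condition at $x=R$ in the system is not part of the definition of super/sub solution. *)

(* Defs.v *)
From HB Require Import structures.
From mathcomp Require Import all_boot all_order all_algebra.
From mathcomp Require Import all_classical all_reals all_analysis.

Set Implicit Arguments.
Unset Strict Implicit.
Unset Printing Implicit Defensive.

Import Order.TTheory GRing.Theory Num.Theory.
Import numFieldNormedType.Exports.

Local Open Scope classical_set_scope.
Local Open Scope ring_scope.

(* The star-shaped network with n rays of length r: the point (x, i) is the    *)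
(* pair of x \in `[0, r] and i : 'I_n, all the (0, i) denoting the junction.   *)
(* A function on the network is a family f : 'I_n -> R -> R; the values of     *)
(* f i outside `[0, r] are irrelevant to every definition below.               *)

Section Network.
Context {R : realType} {n : nat}.
Implicit Types (r x : R) (i j : 'I_n) (f : 'I_n -> R -> R).

(* Geodesic distance; dist (0, i) (0, j) = 0 and dist (0, i) (y, j) = y.       *)
Definition network_dist (p q : R * 'I_n) : R :=
  if p.2 == q.2 then `|p.1 - q.1| else p.1 + q.1.

Definition network_local_min r f x i : Prop :=
  exists2 e : R, 0 < e &
    forall (y : R) j, y \in `[0, r] -> network_dist (x, i) (y, j) < e ->
      f i x <= f j y.

Definition network_local_max r f x i : Prop :=
  exists2 e : R, 0 < e &
    forall (y : R) j, y \in `[0, r] -> network_dist (x, i) (y, j) < e ->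
      f j y <= f i x.

Definition network_continuous r f : Prop :=
  (forall i, {within `[0, r], continuous (f i)}) /\
  (forall i j, f i 0 = f j 0).

(* Derivative relative to `[0, r]: same formula as derive1, but h ranges over  *)
(* the increments keeping h + x in `[0, r]. It is the usual derivative inside  *)
(* the interval and the one-sided derivative at 0 and r.                       *)
Definition diff_quotient r (g : R -> R) x : set_system R :=
  (h^-1 * (g (h + x) - g x))
    @[h --> within [set h | h + x \in `[0, r]] (0 : R)^'].

Definition derivable_on r (g : R -> R) : Prop :=
  forall x, x \in `[0, r] -> cvg (diff_quotient r g x).

Definition derive_on r (g : R -> R) : R -> R :=
  fun x => lim (diff_quotient r g x).

Definition C2_on r (g : R -> R) : Prop :=
  [/\ derivable_on r g,
      derivable_on r (derive_on r g) &
      {within `[0, r], continuous (derive_on r (derive_on r g))}].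

Definition network_C2 r f : Prop :=
  network_continuous r f /\ (forall i, C2_on r (f i)).

End Network.

Section System.
Context {R : realType} {n : nat}.
Variables (r lambda : R) (B : 'I_n -> set R) (O : set 'rV[R]_n).
Variables (sigma b h : 'I_n -> R -> R -> R).
Variables (S : 'I_n -> 'rV[R]_n -> R) (h0 : 'rV[R]_n -> R).

Definition bulk_operator (phi : 'I_n -> R -> R) (i : 'I_n) (x : R) : R :=
  lambda * phi i x +
  sup [set - sigma i x beta * derive_on r (derive_on r (phi i)) x
           + b i x beta * derive_on r (phi i) x
           + h i x beta | beta in B i].

Definition junction_operator (phi : 'I_n -> R -> R) : R :=
  inf [set (\sum_(i < n) S i theta * derive_on r (phi i) 0) + h0 theta
      | theta in O].

Definition viscosity_super (u : 'I_n -> R -> R) : Prop :=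
  network_continuous r u /\
  forall phi : 'I_n -> R -> R, network_C2 r phi ->
  forall (x : R) (i : 'I_n), x \in `[0, r] ->
    network_local_min r (fun j y => u j y - phi j y) x i ->
    u i x - phi i x = 0 ->
    (0 < x < r -> 0 <= bulk_operator phi i x) /\
    (x = 0 -> junction_operator phi <= 0).

Definition viscosity_sub (v : 'I_n -> R -> R) : Prop :=
  network_continuous r v /\
  forall phi : 'I_n -> R -> R, network_C2 r phi ->
  forall (x : R) (i : 'I_n), x \in `[0, r] ->
    network_local_max r (fun j y => v j y - phi j y) x i ->
    v i x - phi i x = 0 ->
    (0 < x < r -> bulk_operator phi i x <= 0) /\
    (x = 0 -> 0 <= junction_operator phi).

Definition assumption_S : Prop :=
  exists2 zeta : R, 0 < zeta & forall i theta, O theta -> zeta <= S i theta.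

Definition assumption_E : Prop :=
  exists2 s : R, 0 < s &
    forall i x beta, x \in `[0, r] -> B i beta -> s <= sigma i x beta.

(* The suprema are taken in \bar R, so that the bound C is a real constraint   *)
(* (the real-valued sup of an unbounded set is 0 by convention).               *)
Definition sup_lip_norm_le (A : set R) (F : R -> R -> R) (C : R) : Prop :=
  (ereal_sup [set `|F p.1 p.2|%:E | p in `[0%R, r]%classic `*` A]
   + ereal_sup [set ereal_sup
       [set (`|F p.1 beta - F p.2 beta| / `|p.1 - p.2|)%:E
         | p in [set p : R * R |
             [/\ p.1 \in `[0%R, r], p.2 \in `[0%R, r] & p.1 != p.2]]]
     | beta in A]
   <= C%:E)%E.

Definition assumption_R : Prop :=
  exists cb ch czeta csigma : R,
    [/\ 0 < cb, 0 < ch, 0 < czeta & 0 < csigma] /\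
    (forall i,
      [/\ sup_lip_norm_le (B i) (b i) cb,
          sup_lip_norm_le (B i) (sigma i) csigma,
          sup_lip_norm_le (B i) (h i) ch,
          (ereal_sup [set `|S i theta|%:E | theta in O] <= czeta%:E)%E &
          (ereal_sup [set `|h0 theta|%:E | theta in O] <= ch%:E)%E]).

End System.

Definition continuous_on_ray {R : realType} (r : R) (A : set R)
    (F : R -> R -> R) : Prop :=
  {within `[0, r] `*` A, continuous (fun p : R * R => F p.1 p.2)}.

(* Main.v *)
Require Import Defs.
From HB Require Import structures.
From mathcomp Require Import all_boot all_order all_algebra.
From mathcomp Require Import all_classical all_reals all_analysis.
From mathcomp Require Import ring lra.

Import Order.TTheory GRing.Theory Num.Theory.
Import numFieldNormedType.Exports.

Local Open Scope classical_set_scope.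
Local Open Scope ring_scope.

(* Uniform ellipticity lets one solve the bulk equation for the second         *)
(* derivative: it reads w'' = G x w w' with G Lipschitz and strictly           *)
(* increasing in w, so that v'' >= G x v v' and u'' <= G x u u' in the         *)
(* viscosity sense. On a short interval around x0, the parabola interpolating  *)
(* v at the endpoints with second derivative G x0 (v x0) slope - eta lies      *)
(* above v, and the symmetric parabola lies below u. If v - u has a positive   *)
(* maximum at an interior point x0, comparing these parabolas at x0 gives a    *)
(* contradiction, because the gap in G of order v x0 - u x0 beats eta. If the  *)
(* maximum is at the junction, the parabolas on [0, d] are admissible test     *)
(* functions there, and the same gap makes the slope for v strictly smaller    *)
(* than the slope for u on every ray; since S >= zeta > 0, this contradicts    *)
(* the two junction conditions. No doubling of variables is needed.            *)

(** On one ray everything rests on [le_chord_near]: if [v'' >= G x v v'] in the viscosity sense,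
    then on every short interval [[a, b]] containing [x0], [v] lies below the parabola through its
    endpoint values with second derivative [G x0 (v x0) s - eta], where [s] is the secant slope. The
    slope may be unbounded, but [s * (b - a)] is an increment of [v], hence small, and this suffices
    for the error of freezing [G] at [x0]. [ge_chord_near] is the mirror statement for [u].

    Suppose [v - u] has a positive maximum. In the interior, [no_interior_max] compares the two
    parabolas at the midpoint of a symmetric interval. At the junction, [junction_parabolas] yields
    on each ray a slope [p] for [v] below a slope [q] for [u], and [junction_inf_lt] turns this into
    a contradiction with the two Kirchhoff conditions. At [r] the boundary inequality excludes it.
    [admissible_hjb_rhs], [hjb_rhs_le] and [hjb_rhs_ge] put the bulk equation in the form
    [w'' = G x w w']. *)

Lemma small_multiple (R : realType) (A e : R) : 0 <= A -> 0 < e ->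
  exists2 t, 0 < t & forall t', t' <= t -> A * t' <= e.
Proof.
move=> A0 e0; exists (e / (A + 1)) => [|t' t'A].
  by rewrite divr_gt0//; lra.
apply: (@le_trans _ _ (A * (e / (A + 1)))); first exact: ler_wpM2l.
rewrite mulrCA ler_piMr//; first exact: ltW.
by rewrite ler_pdivrMr; lra.
Qed.

(** * Comparison of viscosity sub and super solutions with parabolas on one ray *)

Section ray.
Context {R : realType} (r K g : R).
Implicit Types (G : R -> R -> R -> R) (u v : R -> R).

(** The structure of [G] in [w'' = G x w w']. The Lipschitz constant in [x] grows with [z] and [p],
    as a term like [b x be * p] requires. *)
Definition admissible G : Prop :=
  [/\ forall x y z z' p p', x \in `[0, r] -> y \in `[0, r] ->
        `|G x z p - G y z' p'| <=
          K * (`|x - y| * (1 + `|z| + `|p|) + `|z - z'| + `|p - p'|),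
      forall x z z' p, x \in `[0, r] -> z' <= z ->
        g * (z - z') <= G x z p - G x z' p &
      forall x z p, x \in `[0, r] -> `|G x z p| <= K * (1 + `|z| + `|p|)].

Definition parabola_sub G v : Prop :=
  forall y p c e, 0 < y < r -> 0 < e ->
    (forall x, x \in `[0, r] -> `|x - y| < e ->
       v x <= v y + p * (x - y) + c / 2 * (x - y) ^+ 2) ->
    G y (v y) p <= c.

Definition parabola_super G u : Prop :=
  forall y p c e, 0 < y < r -> 0 < e ->
    (forall x, x \in `[0, r] -> `|x - y| < e ->
       u y + p * (x - y) + c / 2 * (x - y) ^+ 2 <= u x) ->
    c <= G y (u y) p.

(* The parabola with second derivative c that passes through (a, v a) and, if   *)
(* s is the slope of the secant of v, through (b, v b).                         *)
Definition chord (v : R -> R) (a b s c x : R) : R :=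
  v a + s * (x - a) + c / 2 * (x - a) * (x - b).

(** If [u'' <= G x u u'], then [w = - u] satisfies [w'' >= flip G x w w']; this transfers results
    from sub to super solutions. *)
Definition flip G : R -> R -> R -> R := fun x z p => - G x (- z) (- p).

Lemma admissible_flip G : admissible G -> admissible (flip G).
Proof.
move=> [Glip Gmon Gbd]; split => [x y z z' p p' xr yr|x z z' p xr zz'|x z p xr].
- have := Glip _ _ (- z) (- z') (- p) (- p') xr yr.
  by rewrite /flip -!opprD !normrN.
- have := Gmon x (- z') (- z) (- p) xr; rewrite lerN2 => /(_ zz').
  by rewrite /flip; lra.
- by rewrite /flip normrN; have := Gbd x (- z) (- p) xr; rewrite !normrN.
Qed.

Lemma parabola_super_flip G u :
  parabola_super G u -> parabola_sub (flip G) (\- u).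
Proof.
move=> usup y p c e yr e0 ule; rewrite /flip opprK lerNl.
apply: (usup y (- p) (- c) e) => // x xr xy.
by have := ule x xr xy; rewrite /=; lra.
Qed.

Lemma chord_flip u a b s c x :
  chord (\- u) a b s c x = - chord u a b (- s) (- c) x.
Proof. by rewrite /chord /=; ring. Qed.

Hypothesis g_gt0 : 0 < g.

(** The parabola is a strict super solution. At an interior positive maximum [y] of [v] minus the
    parabola, a vertical translate touches [v] from above, so [G y (v y) p <= c], whereas
    monotonicity in [z] gives [c < G y (v y) p]. At [a] and [b] the difference vanishes. *)
Lemma le_chord G v a b s c :
  admissible G -> parabola_sub G v -> {within `[0, r], continuous v} ->
  0 <= a -> a < b -> b <= r -> s * (b - a) = v b - v a ->
  (forall x, a < x < b ->
     c < G x (chord v a b s c x) (s + c / 2 * (2 * x - a - b))) ->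
  forall x, x \in `[a, b] -> v x <= chord v a b s c x.
Proof.
move=> [_ Gmon _] vsub vcont a0 ab br sE cG x xab.
have abr : `[a, b]%classic `<=` `[0, r]%classic.
  by move=> z /=; rewrite !in_itv/= => /andP[az zb]; apply/andP; split; lra.
have fcont : {within `[a, b], continuous (fun x => v x - chord v a b s c x)}.
  apply: (@within_continuousB R R R); first exact: continuous_subspaceW vcont.
  apply: continuous_subspaceT => z; rewrite /chord.
  apply: cvgD; [apply: cvgD|apply: cvgM; [apply: cvgM|]].
  - exact: cvg_cst.
  - apply: cvgM; [exact: cvg_cst|apply: cvgB; [exact: cvg_id|exact: cvg_cst]].
  - exact: cvg_cst.
  - apply: cvgB; [exact: cvg_id|exact: cvg_cst].
  - apply: cvgB; [exact: cvg_id|exact: cvg_cst].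
have [y] := EVT_max (ltW ab) fcont.
rewrite in_itv/= => /andP[ay yb] ymax.
rewrite -subr_le0 (le_trans (ymax x xab))//.
rewrite leNgt; apply/negP => y0.
have ya : a < y.
  rewrite lt_neqAle ay andbT; apply/eqP => ya; move: y0.
  by rewrite -ya /chord; lra.
have {}yb : y < b.
  rewrite lt_neqAle yb andbT; apply/eqP => yb'; move: y0.
  by rewrite yb' /chord !subrr mulr0 sE; lra.
have yr : y \in `[0, r] by rewrite in_itv/=; apply/andP; split; lra.
have := cG y; rewrite ya yb => /(_ isT).
rewrite ltNge => /negP; apply.
set p := s + _.
apply: (@le_trans _ _ (G y (v y) p)).
  have := Gmon y (v y) (chord v a b s c y) p yr.
  have vy : chord v a b s c y <= v y by lra.
  move=> /(_ vy).
  have : 0 <= g * (v y - chord v a b s c y) by rewrite mulr_ge0// ltW.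
  lra.
apply: (vsub y p c (Num.min (y - a) (b - y))).
- by apply/andP; split; lra.
- by rewrite lt_min; apply/andP; split; lra.
- move=> z zr; rewrite lt_min => /andP[].
  rewrite !ltr_norml => /andP[z1 z2] /andP[z3 z4].
  have zab : z \in `[a, b] by rewrite in_itv/=; apply/andP; split; lra.
  have := ymax z zab; rewrite /p /chord; lra.
Qed.

(** The coefficient may blow up with [s], but only linearly, so its product with the length is
    controlled by the length and the oscillation [om]. *)
Lemma chord_coef_le G v x0 eta om a b s :
  admissible G -> 0 <= K -> x0 \in `[0, r] -> 0 < eta -> a < b ->
  `|s| * (b - a) <= 2 * om ->
  `|G x0 (v x0) s - eta| * (b - a) <=
    (K * (1 + `|v x0|) + eta) * (b - a) + 2 * K * om.
Proof.
move=> [_ _ Gbd] K0 x0r eta0 ab sl.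
have {Gbd}cle : `|G x0 (v x0) s - eta| <= K * (1 + `|v x0|) + eta + K * `|s|.
  rewrite (le_trans (ler_normB _ _))// (gtr0_norm eta0).
  by have := Gbd x0 (v x0) s x0r; lra.
have l0 : 0 <= b - a by lra.
have := ler_wpM2r l0 cle; have := ler_wpM2l K0 sl; lra.
Qed.

Lemma chord_dist_le v x0 om a b s c x :
  a <= x <= b -> b - a <= 1 -> `|v x0 - v a| <= om ->
  `|s| * (b - a) <= 2 * om ->
  `|v x0 - chord v a b s c x| <= 3 * om + `|c| * (b - a).
Proof.
move=> /andP[ax xb] l1 va sl.
have xa_l : `|x - a| <= b - a by rewrite ger0_norm; lra.
have -> : v x0 - chord v a b s c x =
    (v x0 - v a) - s * (x - a) - c * (((x - a) * (x - b)) / 2).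
  by rewrite /chord; field.
rewrite (le_trans (ler_normB _ _))// lerD//.
  rewrite (le_trans (ler_normB _ _))// normrM.
  by have := ler_wpM2l (normr_ge0 s) xa_l; move: va sl; clear; lra.
rewrite normrM ler_wpM2l//.
have -> : (x - a) * (x - b) / 2 = (x - a) * ((x - b) / 2) by ring.
rewrite normrM -[leRHS]mulr1 ler_pM// ler_norml.
by move: ax xb l1; clear => *; apply/andP; split; lra.
Qed.

(** This is the error of freezing [G] at [x0]. The dangerous term [|x0 - x| * |s|] is at most
    [|s| * (b - a) <= 2 * om]; the errors in value and in slope are bounded through
    [|c| * (b - a)]. *)
Lemma chord_rhs_le G v x0 eta om a b s c x :
  admissible G -> 0 <= K -> x0 \in `[0, r] -> x \in `[0, r] -> 0 < eta ->
  a < b -> a <= x0 <= b -> a <= x <= b -> b - a <= 1 ->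
  `|v x0 - v a| <= om -> `|v x0 - v b| <= om -> s * (b - a) = v b - v a ->
  c = G x0 (v x0) s - eta ->
  G x0 (v x0) s - G x (chord v a b s c x) (s + c / 2 * (2 * x - a - b)) <=
    (5 * K + 4 * K ^+ 2) * om
    + (K * (1 + `|v x0|) + 2 * K * (K * (1 + `|v x0|) + eta)) * (b - a).
Proof.
move=> Gadm K0 x0r xr eta0 ab /andP[ax0 x0b] /andP[ax xb] l1 va vb sE cE.
have l0 : 0 < b - a by rewrite subr_gt0.
have sl : `|s| * (b - a) <= 2 * om.
  rewrite -[b - a]gtr0_norm// -normrM sE.
  have -> : v b - v a = (v x0 - v a) - (v x0 - v b) by ring.
  by rewrite (le_trans (ler_normB _ _))//; move: va vb; clear; lra.
have cl := chord_coef_le G v x0 _ _ _ _ _ Gadm K0 x0r eta0 ab sl.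
rewrite -cE in cl.
have axb : a <= x <= b by rewrite ax.
have vw := chord_dist_le v x0 _ _ _ _ c _ axb l1 va sl.
have x0x : `|x0 - x| <= b - a.
  by rewrite ler_norml; move: ax0 x0b ax xb; clear => *; apply/andP; split; lra.
have pp : `|s - (s + c / 2 * (2 * x - a - b))| <= `|c| * (b - a).
  have -> : s - (s + c / 2 * (2 * x - a - b)) = c * (- ((2 * x - a - b) / 2)).
    by field.
  rewrite normrM ler_wpM2l// ler_norml.
  by move: ax xb; clear => *; apply/andP; split; lra.
have [Glip _ _] := Gadm.
apply: le_trans (le_trans (ler_norm _) (Glip _ _ _ _ _ _ x0r xr)) _.
have : `|x0 - x| * (1 + `|v x0| + `|s|) <=
    (b - a) * (1 + `|v x0|) + 2 * om.
  apply: (@le_trans _ _ ((b - a) * (1 + `|v x0| + `|s|))).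
    by rewrite ler_wpM2r// !addr_ge0.
  by move: sl; clear; lra.
move=> /lerD/(_ vw)/lerD/(_ pp)/(ler_wpM2l K0) H.
apply: le_trans H _.
by have := ler_wpM2l K0 cl; clear; lra.
Qed.

End ray.

(** Each of the two terms in [chord_rhs_le] is made at most [eta / 4], so the freezing error stays
    below [eta] and [le_chord] applies. The threshold on [d] does not depend on [a], [b] or [s]. *)
Lemma le_chord_near (R : realType) (r K g : R) G v x0 eta :
  0 < g -> admissible r K g G -> parabola_sub r G v -> {within `[0, r], continuous v} ->
  0 <= K -> x0 \in `[0, r] -> 0 < eta ->
  \forall d \near 0^'+, forall a b s,
    0 <= a -> a <= x0 -> x0 <= b -> b <= r -> a < b -> b - a < d ->
    s * (b - a) = v b - v a ->
    forall x, x \in `[a, b] ->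
      v x <= chord v a b s (G x0 (v x0) s - eta) x.
Proof.
move=> g0 Gadm vsub vcont K0 x0r eta0.
have [|om om0 /(_ om (lexx _)) Aom] := small_multiple _ (5 * K + 4 * K ^+ 2)
    (eta / 4) _ (divr_gt0 eta0 (ltr0n _ 4)).
  by rewrite addr_ge0 ?mulr_ge0 ?exprn_ge0.
have [|d1 d10 Ed] :=
    small_multiple _ (K * (1 + `|v x0|) + 2 * K * (K * (1 + `|v x0|) + eta))
      (eta / 4) _ (divr_gt0 eta0 (ltr0n _ 4)).
  by rewrite !(addr_ge0, mulr_ge0)// ltW.
have [d0 /= d00 vd0] : exists2 d0 : R, 0 < d0 & forall z, z \in `[0, r] ->
    `|x0 - z| < d0 -> `|v x0 - v z| <= om.
  have /subspace_continuousP/(_ x0 x0r) := vcont.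
  move=> /cvgrPdist_le/(_ om om0)/=.
  rewrite /prop_near1/within/= => -[d0 /= d00 H]; exists d0 => // z zr xz.
  exact: (H z xz zr).
near=> d => a b s a0 ax0 x0b br ab bad sE.
have dle1 : d <= 1 by near: d; exact: nbhs_right_le.
have dd0 : d <= d0 by near: d; exact: nbhs_right_le.
have dd1 : d <= d1 by near: d; exact: nbhs_right_le.
apply: (le_chord r K g g0 G v a b s _ Gadm vsub vcont a0 ab br sE) => x /andP[ax xb].
rewrite ltrBlDr -ltrBlDl.
apply: le_lt_trans (chord_rhs_le r K g G v x0 eta om _ _ _ _ _ Gadm
  _ _ _ _ _ _ _ _ _ _ sE erefl) _ => //.
- by rewrite in_itv/=; move: ax xb a0 br; clear => *; apply/andP; split; lra.
- by rewrite ax0.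
- by rewrite !ltW.
- by move: bad dle1; clear; lra.
- apply: vd0; first by rewrite in_itv/= a0 (le_trans ax0)// (le_trans x0b).
  by rewrite ger0_norm; move: ax0 x0b bad dd0; clear; lra.
- apply: vd0; first by rewrite in_itv/= br (le_trans a0)// (le_trans ax0).
  by rewrite ler0_norm; move: ax0 x0b bad dd0; clear; lra.
- have /Ed : b - a <= d1 by move: bad dd1; clear; lra.
  by move: Aom eta0; clear; lra.
Unshelve. all: by end_near. Qed.

Lemma ge_chord_near (R : realType) (r K g : R) G u x0 eta :
  0 < g -> admissible r K g G -> parabola_super r G u ->
  {within `[0, r], continuous u} ->
  0 <= K -> x0 \in `[0, r] -> 0 < eta ->
  \forall d \near 0^'+, forall a b s,
    0 <= a -> a <= x0 -> x0 <= b -> b <= r -> a < b -> b - a < d ->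
    s * (b - a) = u b - u a ->
    forall x, x \in `[a, b] ->
      chord u a b s (G x0 (u x0) s + eta) x <= u x.
Proof.
move=> g0 Gadm usup ucont K0 x0r eta0.
have Nucont : {within `[0, r], continuous (\- u)}.
  by move=> z; apply: cvgN; exact: ucont.
have := le_chord_near _ _ _ _ _ _ x0 eta g0 (admissible_flip _ _ _ _ Gadm)
  (parabola_super_flip _ _ _ usup) Nucont K0 x0r eta0.
apply: filterS => d H a b s a0 ax0 x0b br ab bad sE x xab.
have := H a b (- s) a0 ax0 x0b br ab bad.
rewrite /flip /= !opprK mulNr sE => /(_ _ x xab).
rewrite -opprD chord_flip !opprK lerN2; apply.
by rewrite opprB addrC.
Qed.

(** * Positive maxima of the difference: interior points and the junction *)

Lemma admissible_gap (R : realType) (r K g : R) G x z z' p p' :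
  admissible r K g G -> x \in `[0, r] -> z' <= z ->
  g * (z - z') - K * `|p - p'| <= G x z p - G x z' p'.
Proof.
move=> [Glip Gmon _] xr zz'.
have := Gmon x z z' p xr zz'.
have := Glip x x z' z' p' p xr xr.
rewrite !subrr !normr0 mul0r !add0r => /(le_trans (ler_norm _)).
rewrite (distrC p'); lra.
Qed.

Lemma no_interior_max (R : realType) (r K g : R) G u v x0 :
  0 < g -> 0 <= K -> admissible r K g G ->
  parabola_sub r G v -> parabola_super r G u ->
  {within `[0, r], continuous v} -> {within `[0, r], continuous u} ->
  0 < x0 < r -> u x0 < v x0 ->
  ~ (forall x, x \in `[0, r] -> v x - u x <= v x0 - u x0).
Proof.
move=> g0 K0 Gadm vsub usup vcont ucont /andP[x00 x0r] uv wmax.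
have x0I : x0 \in `[0, r] by rewrite in_itv/= !ltW.
pose eta := g * (v x0 - u x0) / 4.
have eta0 : 0 < eta by rewrite divr_gt0// mulr_gt0// subr_gt0.
have [d1 d10 Kd1] := small_multiple _ K 1 K0 ltr01.
suff [d [d0 [dx0 [dr [Kd [vle ule]]]]]] : exists d, 0 < d /\ d <= x0 /\
    d <= r - x0 /\ K * d <= 1 /\
    (forall s, s * (x0 + d - (x0 - d)) = v (x0 + d) - v (x0 - d) ->
      v x0 <= chord v (x0 - d) (x0 + d) s (G x0 (v x0) s - eta) x0) /\
    (forall s, s * (x0 + d - (x0 - d)) = u (x0 + d) - u (x0 - d) ->
      chord u (x0 - d) (x0 + d) s (G x0 (u x0) s + eta) x0 <= u x0).
  pose sv := (v (x0 + d) - v (x0 - d)) / (x0 + d - (x0 - d)).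
  pose su := (u (x0 + d) - u (x0 - d)) / (x0 + d - (x0 - d)).
  have dd : x0 + d - (x0 - d) != 0 by rewrite gt_eqF//; move: d0; clear; lra.
  have svE : sv * (x0 + d - (x0 - d)) = v (x0 + d) - v (x0 - d) by rewrite mulfVK.
  have suE : su * (x0 + d - (x0 - d)) = u (x0 + d) - u (x0 - d) by rewrite mulfVK.
  have {vle} := vle _ svE; have {ule} := ule _ suE.
  have := admissible_gap _ r K g G x0 _ _ sv su Gadm x0I (ltW uv).
  have w1 : v (x0 - d) - u (x0 - d) <= v x0 - u x0.
    by apply: wmax; rewrite in_itv/=; move: x00 x0r d0 dx0; clear => *;
      apply/andP; split; lra.
  have w2 : v (x0 + d) - u (x0 + d) <= v x0 - u x0.
    by apply: wmax; rewrite in_itv/=; move: x00 x0r d0 dr; clear => *;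
      apply/andP; split; lra.
  rewrite (_ : g * _ = 4 * eta); last by rewrite /eta; field.
  rewrite /chord.
  set cv := G x0 (v x0) sv; set cu := G x0 (u x0) su.
  move=> gap ule vle.
  (* The second derivative of the parabola for [v] minus that of the parabola for [u]. *)
  pose c := cv - cu - 2 * eta.
  (* The drops of [v - u] from [x0] to [x0 - d] and [x0 + d] are nonnegative. Half their sum is at
     most [- c / 2 * d * d] by the midpoint inequalities; half their difference is [(sv - su) * d]
     up to sign. *)
  have Dd : `|sv - su| * d <= - c / 2 * d * d.
    rewrite -[d in X in X <= _]gtr0_norm// -normrM ler_norml.
    move: svE suE w1 w2 ule vle; rewrite /c; clear => *.
    by apply/andP; split; lra.
  have {Dd} Dle : `|sv - su| <= - c / 2 * d by rewrite -(ler_pM2r d0).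
  have D0 := normr_ge0 (sv - su).
  have KD : K * `|sv - su| <= - c / 2.
    apply: le_trans (ler_wpM2l K0 Dle) _.
    have c0 : 0 <= - c / 2 by rewrite -(pmulr_lge0 _ d0) (le_trans D0).
    by have := ler_wpM2l c0 Kd; clear; lra.
  (* [gap] gives [2 * eta - K * |sv - su| <= c], and with [KD] this becomes [2 * eta <= c / 2]. *)
  have c_gt : 0 < c by move: gap KD eta0; rewrite /c; clear; lra.
  have : - c / 2 * d < 0.
    by rewrite pmulr_llt0//; move: c_gt; clear; lra.
  by move: Dle D0; clear; lra.
near (0 : R)^'+ => D.
have D0 : 0 < D by near: D; exact: nbhs_right_gt.
have Dx0 : D <= x0 by near: D; exact: nbhs_right_le.
have Dr : D <= r - x0 by near: D; apply: nbhs_right_le; rewrite subr_gt0.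
have DK : D <= d1 by near: D; exact: nbhs_right_le.
have lo : 0 <= x0 - D / 3 by move: D0 Dx0; clear; lra.
have hi : x0 + D / 3 <= r by move: D0 Dr; clear; lra.
have lx0 : x0 - D / 3 <= x0 by move: D0; clear; lra.
have x0h : x0 <= x0 + D / 3 by move: D0; clear; lra.
have lh : x0 - D / 3 < x0 + D / 3 by move: D0; clear; lra.
have lD : x0 + D / 3 - (x0 - D / 3) < D by move: D0; clear; lra.
have x0in : x0 \in `[x0 - D / 3, x0 + D / 3] by rewrite in_itv/= lx0.
exists (D / 3); split; first by move: D0; clear; lra.
split; first by move: D0 Dx0; clear; lra.
split; first by move: D0 Dr; clear; lra.
split; first by apply: Kd1; move: D0 DK; clear; lra.
split=> s sE.
- by apply: (near (le_chord_near _ _ _ _ _ _ x0 eta g0 Gadm vsub vcont K0 x0I eta0) D).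
- by apply: (near (ge_chord_near _ _ _ _ _ _ x0 eta g0 Gadm usup ucont
    K0 x0I eta0) D).
Unshelve. all: by end_near. Qed.

(** The parabolas over [[0, d]] have initial slopes [sv - cv / 2 * d] and [su - cu / 2 * d], where
    [cv - cu >= 2 * eta + K * (sv - su)] and [sv <= su] by maximality at [0]. Hence [p - q <= (sv -
    su) * (1 - K * d / 2) - d * eta], which is negative once [K * d <= 1]. *)
Lemma junction_parabolas (R : realType) (r K g : R) G u v :
  0 < r -> 0 < g -> 0 <= K -> admissible r K g G ->
  parabola_sub r G v -> parabola_super r G u ->
  {within `[0, r], continuous v} -> {within `[0, r], continuous u} ->
  u 0 < v 0 -> (forall x, x \in `[0, r] -> v x - u x <= v 0 - u 0) ->
  exists t : R * R * R * R * R, let: (d, p, q, cv, cu) := t in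
    [/\ 0 < d, p < q,
      forall x, 0 <= x < d -> v x <= v 0 + p * x + cv * x ^+ 2 &
      forall x, 0 <= x < d -> u 0 + q * x + cu * x ^+ 2 <= u x].
Proof.
move=> r0 g0 K0 Gadm vsub usup vcont ucont uv wmax.
have zI : 0 \in `[0, r] by rewrite in_itv/= lexx ltW.
pose eta := g * (v 0 - u 0) / 4.
have eta0 : 0 < eta by rewrite divr_gt0// mulr_gt0// subr_gt0.
have [d1 d10 Kd1] := small_multiple _ K 1 K0 ltr01.
near (0 : R)^'+ => D.
have D0 : 0 < D by near: D; exact: nbhs_right_gt.
have Dr : D <= r by near: D; exact: nbhs_right_le.
have DK : D <= d1 by near: D; exact: nbhs_right_le.
pose d := D / 2.
have d0 : 0 < d by rewrite /d; move: D0; clear; lra.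
have dr : d <= r by rewrite /d; move: D0 Dr; clear; lra.
have dD : d - 0 < D by rewrite /d; move: D0; clear; lra.
have Kd : K * d <= 1 by apply: Kd1; rewrite /d; move: D0 DK; clear; lra.
pose sv := (v d - v 0) / d; pose su := (u d - u 0) / d.
have svE : sv * (d - 0) = v d - v 0 by rewrite subr0 mulfVK// gt_eqF.
have suE : su * (d - 0) = u d - u 0 by rewrite subr0 mulfVK// gt_eqF.
pose cv := G 0 (v 0) sv - eta; pose cu := G 0 (u 0) su + eta.
have vle x : x \in `[0, d] -> v x <= chord v 0 d sv cv x.
  move: x; apply: (near (le_chord_near _ _ _ _ _ _ 0 eta g0 Gadm vsub vcont
    K0 zI eta0) D) => //.
  exact: ltW.
have ule x : x \in `[0, d] -> chord u 0 d su cu x <= u x.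
  move: x; apply: (near (ge_chord_near _ _ _ _ _ _ 0 eta g0 Gadm usup ucont
    K0 zI eta0) D) => //.
  exact: ltW.
exists (d, sv - cv / 2 * d, su - cu / 2 * d, cv / 2, cu / 2); split => //.
- have := admissible_gap _ r K g G 0 _ _ sv su Gadm zI (ltW uv).
  rewrite (_ : g * _ = 4 * eta); last by rewrite /eta; field.
  have w1 : v d - u d <= v 0 - u 0 by apply: wmax; rewrite in_itv/= ltW.
  have Dle : sv - su <= 0.
    by rewrite -(pmulr_lle0 _ d0); move: svE suE w1; clear; lra.
  rewrite (ler0_norm Dle).
  have : (sv - su) * (1 - K * d / 2) <= 0.
    by rewrite pmulr_lle0//; move: Kd; clear; lra.
  move=> H1 H2.
  have := ler_wpM2l (ltW d0) H2; have := mulr_gt0 d0 eta0.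
  by move: H1; rewrite /cv /cu; clear; lra.
- move=> x /andP[x0 xd].
  have := vle x; rewrite in_itv/= x0 (ltW xd) => /(_ isT).
  by rewrite /chord; clear; lra.
- move=> x /andP[x0 xd].
  have := ule x; rewrite in_itv/= x0 (ltW xd) => /(_ isT).
  by rewrite /chord; clear; lra.
Unshelve. all: by end_near. Qed.

(** * Relative derivatives of quadratic test functions *)

(** This makes limits of difference quotients unique. Small increments stay in [[0, r]] to the right
    if [x <= r / 2], to the left otherwise. *)
Lemma proper_diff_within (R : realType) (r x : R) : 0 < r -> x \in `[0, r] ->
  ProperFilter (within [set h | h + x \in `[0, r]] (0 : R)^').
Proof.
move=> r0 xr; apply: Build_ProperFilter_ex => A /=.
rewrite /within/= => -[e /= e0 H].
pose t := Num.min (e / 2) (r / 2).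
have t0 : 0 < t by rewrite lt_min !divr_gt0.
have te : t < e by rewrite gt_min ltr_pdivrMr// ltr_pMr// ltr1n.
have tr : t <= r / 2 by rewrite ge_min lexx orbT.
have [xle|xgt] := leP x (r / 2).
  exists t; apply: H; rewrite /= ?sub0r ?normrN ?gtr0_norm ?gt_eqF//.
  by move: xr; rewrite !in_itv/= => /andP[? ?]; apply/andP; split; lra.
exists (- t); apply: H; rewrite /= ?sub0r ?opprK ?gtr0_norm ?oppr_eq0 ?gt_eqF//.
by move: xr; rewrite !in_itv/= => /andP[? ?]; apply/andP; split; lra.
Qed.

(** The quotient equals [B + 2 * C * x + C * h]. Agreement is assumed on [[0, r]] only, so that the
    lemma also applies to [derive_on r f]. *)
Lemma diff_quotient_quadratic (R : realType) (r : R) (f : R -> R) A B C x :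
  (forall y, y \in `[0, r] -> f y = A + B * y + C * y ^+ 2) ->
  x \in `[0, r] -> diff_quotient r f x --> B + 2 * C * x.
Proof.
move=> fE xr; rewrite /diff_quotient.
apply: (@cvg_trans _ ((B + 2 * C * x + C * h)
  @[h --> within [set h | h + x \in `[0, r]] (0 : R)^'])).
  apply: near_eq_cvg; rewrite near_withinE.
  near=> h => hxr; rewrite !fE//.
  have h0 : h != 0 by near: h; exact: nbhs_dnbhs_neq.
  by field.
apply: cvg_within_filter; apply: (@cvg_within_filter _ _ _ (nbhs 0)).
have : (B + 2 * C * x + C * h) @[h --> (0 : R)] --> B + 2 * C * x + C * 0.
  by apply: cvgD; [exact: cvg_cst|apply: cvgM; [exact: cvg_cst|exact: cvg_id]].
by rewrite mulr0 addr0.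
Unshelve. all: by end_near. Qed.

Section quadratic.
Context {R : realType} (r : R) (f : R -> R) (A B C : R).
Hypothesis r_gt0 : 0 < r.
Hypothesis fE : forall y, y \in `[0, r] -> f y = A + B * y + C * y ^+ 2.

Lemma derive_on_quadratic x : x \in `[0, r] -> derive_on r f x = B + 2 * C * x.
Proof.
move=> xr; have PF := proper_diff_within _ _ _ r_gt0 xr.
apply: (@cvg_lim R); first exact: Rhausdorff.
exact: diff_quotient_quadratic fE xr.
Qed.

Lemma derive_on2_quadratic x : x \in `[0, r] ->
  derive_on r (derive_on r f) x = 2 * C.
Proof.
move=> xr; have PF := proper_diff_within _ _ _ r_gt0 xr.
apply: (@cvg_lim R); first exact: Rhausdorff.
rewrite (_ : 2 * C = 2 * C + 2 * 0 * x); last by rewrite mulr0 mul0r addr0.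
apply: (@diff_quotient_quadratic _ _ _ B) => // y yr.
by rewrite derive_on_quadratic// mul0r addr0.
Qed.

Lemma C2_on_quadratic : C2_on r f.
Proof.
split.
- move=> x xr; apply/cvg_ex; exists (B + 2 * C * x).
  exact: diff_quotient_quadratic fE xr.
- move=> x xr; apply/cvg_ex; exists (2 * C + 2 * 0 * x).
  apply: (@diff_quotient_quadratic _ _ _ B) => // y yr.
  by rewrite derive_on_quadratic// mul0r addr0.
- apply: (@subspace_eq_continuous _ _ _ (fun=> 2 * C)).
    by move=> x; rewrite inE/= => xr; apply/esym/derive_on2_quadratic.
  by move=> x; exact: cvg_cst.
Qed.

End quadratic.

Lemma continuous_quadratic (R : realType) (A B C : R) :
  continuous (fun x => A + B * x + C * x ^+ 2).
Proof.
move=> x; apply: cvgD; first apply: cvgD.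
- exact: cvg_cst.
- by apply: cvgM; [exact: cvg_cst|exact: cvg_id].
- by apply: cvgM; [exact: cvg_cst|exact: exprn_continuous].
Qed.

Lemma network_C2_quadratic (R : realType) (n : nat) (r : R) (A B C : 'I_n -> R) :
  0 < r -> (forall i j, A i = A j) ->
  network_C2 r (fun i x => A i + B i * x + C i * x ^+ 2).
Proof.
move=> r0 AE; split; last by move=> i; exact: C2_on_quadratic.
split=> [i|i j]; last by rewrite !mulr0 expr0n !mulr0 !addr0 (AE i j).
by apply: continuous_subspaceT; exact: continuous_quadratic.
Qed.

(** * Suprema over controls and pointwise bounds on the data *)

Lemma sup_image_leD (R : realType) (T : Type) (A : set T) (f g : T -> R) e :
  A !=set0 -> has_ubound (g @` A) -> (forall a, A a -> f a <= g a + e) ->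
  sup (f @` A) <= sup (g @` A) + e.
Proof.
move=> [a0 Aa0] gub fg; apply: ge_sup; first by exists (f a0), a0.
move=> _ [a Aa <-]; rewrite (le_trans (fg a Aa))// lerD2r.
by apply: ub_le_sup => //; exists a.
Qed.

Lemma ler_norm_sup_image (R : realType) (T : Type) (A : set T) (f : T -> R) e :
  A !=set0 -> (forall a, A a -> `|f a| <= e) -> `|sup (f @` A)| <= e.
Proof.
move=> [a0 Aa0] fe.
have fub : ubound (f @` A) e.
  by move=> _ [a Aa <-]; exact: le_trans (ler_norm _) (fe a Aa).
rewrite ler_norml; apply/andP; split.
  apply: (@le_trans _ _ (f a0)); first by have := fe a0 Aa0; rewrite ler_norml => /andP[].
  by apply: ub_le_sup; [exists e|exists a0].
by apply: ge_sup => //; exists (f a0), a0.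
Qed.

Definition bounded_lipschitz {R : realType} (r C : R) (A : set R)
    (F : R -> R -> R) : Prop :=
  (forall x be, x \in `[0, r] -> A be -> `|F x be| <= C) /\
  (forall x y be, x \in `[0, r] -> y \in `[0, r] -> A be ->
     `|F x be - F y be| <= C * `|x - y|).

Lemma bounded_lipschitzW (R : realType) (r C C' : R) (A : set R) F :
  C <= C' -> bounded_lipschitz r C A F -> bounded_lipschitz r C' A F.
Proof.
move=> CC' [F1 F2]; split=> [x be xr Abe|x y be xr yr Abe].
  exact: le_trans (F1 x be xr Abe) CC'.
by apply: le_trans (F2 x y be xr yr Abe) _; rewrite ler_wpM2r.
Qed.

Lemma bounded_lipschitz_sup (R : realType) (r : R) (A : set R) F (C : R) :
  0 < r -> A !=set0 -> sup_lip_norm_le r A F C -> bounded_lipschitz r C A F.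
Proof.
move=> r0 [be0 Abe0]; rewrite /sup_lip_norm_le.
set S1 := ereal_sup _; set S2 := ereal_sup _ => SC.
have zI : (0 : R) \in `[0, r] by rewrite in_itv/= lexx ltW.
have rI : r \in `[0, r] by rewrite in_itv/= lexx ltW.
have S1ub x be : x \in `[0, r] -> A be -> (`|F x be|%:E <= S1)%E.
  by move=> xr Abe; apply: ereal_sup_ubound; exists (x, be).
have S2ub x y be : x \in `[0, r] -> y \in `[0, r] -> x != y -> A be ->
    ((`|F x be - F y be| / `|x - y|)%:E <= S2)%E.
  move=> xr yr xy Abe.
  apply: (@le_trans _ _ (ereal_sup
      [set (`|F p.1 be - F p.2 be| / `|p.1 - p.2|)%:E
         | p in [set p : R * R |
             [/\ p.1 \in `[0%R, r], p.2 \in `[0%R, r] & p.1 != p.2]]])).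
    by apply: ereal_sup_ubound; exists (x, y).
  by apply: ereal_sup_ubound; exists be.
(* Each supremum is bounded by [C] because the other is nonnegative. An empty [ereal_sup] would be
   [-oo], hence the witnesses: [be0], and the distinct points [0] and [r] for [S2]. *)
have S10 : (0 <= S1)%E by rewrite (le_trans _ (S1ub 0 be0 zI Abe0)).
have S20 : (0 <= S2)%E.
  have r_neq0 : 0 != r by rewrite lt_eqF.
  by apply: le_trans (S2ub 0 r be0 zI rI r_neq0 Abe0); rewrite lee_tofin ?divr_ge0.
split=> [x be xr Abe|x y be xr yr Abe].
  rewrite -lee_fin (le_trans (S1ub x be xr Abe))// (le_trans _ SC)//.
  by rewrite leeDl.
have [->|xy] := eqVneq x y; first by rewrite !subrr normr0 mulr0.
rewrite -ler_pdivrMr; last by rewrite normr_gt0 subr_eq0.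
rewrite -lee_fin (le_trans (S2ub x y be xr yr xy Abe))// (le_trans _ SC)//.
by rewrite leeDr.
Qed.

(** * The Hamilton-Jacobi-Bellman equation solved for the second derivative *)

Section hjb.
Context {R : realType} {r lambda C s : R} {A : set R} {sigma b h : R -> R -> R}.
Hypotheses (r_gt0 : 0 < r) (lambda_gt0 : 0 < lambda) (C_gt0 : 0 < C).
Hypotheses (s_gt0 : 0 < s) (A_neq0 : A !=set0).
Hypothesis sigma_ge : forall x be, x \in `[0, r] -> A be -> s <= sigma x be.

Hypotheses (sigma_bl : bounded_lipschitz r C A sigma).
Hypotheses (b_bl : bounded_lipschitz r C A b) (h_bl : bounded_lipschitz r C A h).

(* The equation solved for the second derivative: w'' = hjb_rhs x w w'. *)
Definition hjb_ratio (x z p be : R) : R :=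
  (b x be * p + h x be + lambda * z) / sigma x be.

Definition hjb_rhs (x z p : R) : R := sup (hjb_ratio x z p @` A).

(** The first term accounts for the numerator of [hjb_ratio], the second for the variation of
    [1 / sigma] in [x]. *)
Definition hjb_lip : R := (C + lambda) / s + (C + lambda) * C / s ^+ 2.

Lemma hjb_lip_ge0 : 0 <= hjb_lip.
Proof. by rewrite addr_ge0// divr_ge0 ?mulr_ge0 ?addr_ge0 ?exprn_ge0// ltW. Qed.

Lemma hjb_num_le x z p be : x \in `[0, r] -> A be ->
  `|b x be * p + h x be + lambda * z| <= (C + lambda) * (1 + `|z| + `|p|).
Proof.
move=> xr Abe.
apply: le_trans (ler_normD _ _) _; rewrite normrM (gtr0_norm lambda_gt0).
have := ler_normD (b x be * p) (h x be); rewrite normrM.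
have := ler_wpM2r (normr_ge0 p) (b_bl.1 x be xr Abe).
have := h_bl.1 x be xr Abe.
have := mulr_ge0 (ltW C_gt0) (normr_ge0 z).
have := mulr_ge0 (ltW lambda_gt0) (normr_ge0 p).
by have := ltW lambda_gt0; lra.
Qed.

Lemma hjb_ratio_le x z p be : x \in `[0, r] -> A be ->
  `|hjb_ratio x z p be| <= hjb_lip * (1 + `|z| + `|p|).
Proof.
move=> xr Abe; rewrite /hjb_ratio normrM normfV.
have sg := sigma_ge x be xr Abe.
have sg0 := lt_le_trans s_gt0 sg.
rewrite (gtr0_norm sg0) ler_pdivrMr//.
apply: le_trans (hjb_num_le _ z p _ xr Abe) _.
rewrite mulrAC ler_wpM2r ?addr_ge0//.
apply: (@le_trans _ _ ((C + lambda) / s * sigma x be)).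
  by rewrite mulrAC ler_pdivlMr// ler_wpM2l// addr_ge0 ?ltW.
rewrite ler_wpM2r ?(ltW sg0)// lerDl.
by rewrite divr_ge0 ?mulr_ge0 ?addr_ge0 ?exprn_ge0// ltW.
Qed.

Lemma hjb_ratio_lip x y z z' p p' be :
  x \in `[0, r] -> y \in `[0, r] -> A be ->
  `|hjb_ratio x z p be - hjb_ratio y z' p' be| <=
    hjb_lip * (`|x - y| * (1 + `|z| + `|p|) + `|z - z'| + `|p - p'|).
Proof.
move=> xr yr Abe.
have sx := sigma_ge x be xr Abe; have sy := sigma_ge y be yr Abe.
have sx0 := lt_le_trans s_gt0 sx; have sy0 := lt_le_trans s_gt0 sy.
pose N := b x be * p + h x be + lambda * z.
pose N' := b y be * p' + h y be + lambda * z'.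
have -> : hjb_ratio x z p be - hjb_ratio y z' p' be =
    (N - N') / sigma y be + N * (sigma y be - sigma x be) / (sigma x be * sigma y be).
  rewrite /hjb_ratio -/N -/N'; field; apply/andP; split; exact: lt0r_neq0.
pose Q := 1 + `|z| + `|p|.
have NN : `|N - N'| <= (C + lambda) * (`|x - y| * Q + `|z - z'| + `|p - p'|).
  have -> : N - N' = (b x be - b y be) * p + b y be * (p - p') +
      (h x be - h y be) + lambda * (z - z') by rewrite /N /N'; ring.
  apply: le_trans (ler_normD _ _) _; rewrite [`|lambda * _|]normrM (gtr0_norm lambda_gt0).
  have := ler_normD ((b x be - b y be) * p + b y be * (p - p')) (h x be - h y be).
  have := ler_normD ((b x be - b y be) * p) (b y be * (p - p')).
  rewrite !normrM.
  have := ler_wpM2r (normr_ge0 p) (b_bl.2 x y be xr yr Abe).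
  have := ler_wpM2r (normr_ge0 (p - p')) (b_bl.1 y be yr Abe).
  have := h_bl.2 x y be xr yr Abe.
  have := mulr_ge0 (ltW C_gt0) (normr_ge0 (z - z')).
  have := mulr_ge0 (ltW lambda_gt0) (normr_ge0 (p - p')).
  have := mulr_ge0 (mulr_ge0 (ltW lambda_gt0) (normr_ge0 (x - y)))
    (addr_ge0 (addr_ge0 ler01 (normr_ge0 z)) (normr_ge0 p)).
  have := mulr_ge0 (mulr_ge0 (ltW C_gt0) (normr_ge0 (x - y))) (normr_ge0 z).
  by rewrite /Q; lra.
have P0 : 0 <= `|x - y| * Q by rewrite mulr_ge0 ?addr_ge0.
have P1 : 0 <= `|x - y| * Q + `|z - z'| + `|p - p'| by rewrite !addr_ge0.
have L0 : 0 <= C + lambda by rewrite addr_ge0// ltW.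
apply: le_trans (ler_normD _ _) _; rewrite /hjb_lip [leRHS]mulrDl lerD//.
  rewrite normrM normfV (gtr0_norm sy0) ler_pdivrMr//.
  apply: le_trans NN _; rewrite -!mulrA ler_wpM2l// mulrCA -[leLHS]mulr1.
  by rewrite ler_wpM2l// mulrC ler_pdivlMr// mul1r.
rewrite normrM normfV (gtr0_norm (mulr_gt0 sx0 sy0)) ler_pdivrMr ?mulr_gt0//.
rewrite normrM distrC.
have Nle : `|N| <= (C + lambda) * Q := hjb_num_le _ z p _ xr Abe.
apply: le_trans (ler_pM _ _ Nle (sigma_bl.2 x y be xr yr Abe)) _ => //.
apply: (@le_trans _ _ ((C + lambda) * C / s ^+ 2 *
    (`|x - y| * Q + `|z - z'| + `|p - p'|) * s ^+ 2)).
  rewrite [leRHS](_ : _ = (C + lambda) * C *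
      (`|x - y| * Q + `|z - z'| + `|p - p'|)); last first.
    by field; exact: lt0r_neq0.
  rewrite [leLHS](_ : _ = (C + lambda) * C * (`|x - y| * Q)); last by ring.
  by apply: ler_wpM2l; [rewrite mulr_ge0// ltW|rewrite -addrA lerDl addr_ge0].
apply: ler_wpM2l; last by rewrite expr2 ler_pM// ltW.
by rewrite mulr_ge0// divr_ge0 ?mulr_ge0 ?exprn_ge0// ltW.
Qed.

Lemma hjb_ratio_has_ubound x z p : x \in `[0, r] ->
  has_ubound (hjb_ratio x z p @` A).
Proof.
move=> xr; exists (hjb_lip * (1 + `|z| + `|p|)) => _ [be Abe <-].
exact: le_trans (ler_norm _) (hjb_ratio_le _ _ _ _ xr Abe).
Qed.

(** The estimates on [hjb_ratio] are uniform in the control and pass to the supremum. Each ratio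
    grows in [z] at rate [lambda / sigma], which is at least [lambda / C]. *)
Lemma admissible_hjb_rhs : admissible r hjb_lip (lambda / C) hjb_rhs.
Proof.
split.
- move=> x y z z' p p' xr yr; rewrite ler_norml lerBlDl lerNl opprB lerBlDl.
  apply/andP; split; apply: sup_image_leD => //; try exact: hjb_ratio_has_ubound;
    move=> be Abe; rewrite -lerBlDl; apply: le_trans (ler_norm _) _.
    by rewrite distrC; exact: hjb_ratio_lip.
  exact: hjb_ratio_lip.
- move=> x z z' p xr zz'.
  suff : hjb_rhs x z' p <= hjb_rhs x z p + - (lambda / C * (z - z')) by lra.
  apply: sup_image_leD => //; first exact: hjb_ratio_has_ubound.
  move=> be Abe; have sx := lt_le_trans s_gt0 (sigma_ge x be xr Abe).
  have sC : sigma x be <= C := le_trans (ler_norm _) (sigma_bl.1 x be xr Abe).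
  have -> : hjb_ratio x z' p be = hjb_ratio x z p be - lambda / sigma x be * (z - z').
    by rewrite /hjb_ratio; field; exact: lt0r_neq0.
  rewrite lerD2l lerN2 ler_wpM2r ?subr_ge0// ler_wpM2l ?(ltW lambda_gt0)//.
  by rewrite lef_pV2.
- move=> x z p xr; apply: ler_norm_sup_image => // be Abe.
  exact: hjb_ratio_le.
Qed.

Lemma bulk_has_ubound x p c : x \in `[0, r] ->
  has_ubound [set - sigma x be * c + b x be * p + h x be | be in A].
Proof.
move=> xr; exists (C * `|c| + C * `|p| + C) => _ [be Abe <-].
apply: lerD; first apply: lerD.
- rewrite (le_trans (ler_norm _))// normrM normrN ler_wpM2r//.
  exact: sigma_bl.1.
- by rewrite (le_trans (ler_norm _))// normrM ler_wpM2r//; exact: b_bl.1.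
- by rewrite (le_trans (ler_norm _))//; exact: h_bl.1.
Qed.

Lemma hjb_rhs_le x z p c : x \in `[0, r] ->
  lambda * z + sup [set - sigma x be * c + b x be * p + h x be | be in A] <= 0 ->
  hjb_rhs x z p <= c.
Proof.
move=> xr H; have [be0 Abe0] := A_neq0.
apply: ge_sup; first by exists (hjb_ratio x z p be0), be0.
move=> _ [be Abe <-]; have sx := lt_le_trans s_gt0 (sigma_ge x be xr Abe).
rewrite /hjb_ratio ler_pdivrMr//.
have : - sigma x be * c + b x be * p + h x be <=
    sup [set - sigma x be * c + b x be * p + h x be | be in A].
  by apply: ub_le_sup; [exact: bulk_has_ubound|exists be].
by move: H; lra.
Qed.

(** If [c] exceeded [hjb_rhs x z p], ellipticity would push every term below [- lambda * z] by the
    fixed amount [s * (c - hjb_rhs x z p)], and hence the supremum too. *)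
Lemma hjb_rhs_ge x z p c : x \in `[0, r] ->
  0 <= lambda * z + sup [set - sigma x be * c + b x be * p + h x be | be in A] ->
  c <= hjb_rhs x z p.
Proof.
move=> xr H; have [be0 Abe0] := A_neq0.
rewrite leNgt; apply/negP => Gc.
suff : sup [set - sigma x be * c + b x be * p + h x be | be in A] <=
    - lambda * z - s * (c - hjb_rhs x z p).
  have : 0 < s * (c - hjb_rhs x z p) by rewrite mulr_gt0// subr_gt0.
  by move: H; lra.
apply: ge_sup; first by exists (- sigma x be0 * c + b x be0 * p + h x be0), be0.
move=> _ [be Abe <-]; have sg := sigma_ge x be xr Abe.
have sx := lt_le_trans s_gt0 sg.
have : hjb_ratio x z p be <= hjb_rhs x z p.
  by apply: ub_le_sup; [exact: hjb_ratio_has_ubound|exists be].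
rewrite {1}/hjb_ratio ler_pdivrMr// => H1.
have cG : 0 <= c - hjb_rhs x z p by rewrite subr_ge0 ltW.
by have := ler_wpM2r cG sg; lra.
Qed.

End hjb.

Arguments hjb_lip {R} lambda C s.
Arguments hjb_rhs {R} lambda A sigma b h x z p.

(** * Viscosity conditions tested with quadratics on the network *)

Lemma network_dist_interior (R : realType) (n : nat) (e x y : R) (i j : 'I_n) :
  0 <= y -> network_dist (x, i) (y, j) < Num.min e x -> i = j /\ `|y - x| < e.
Proof.
rewrite /network_dist /= lt_min => y0; case: eqVneq => [->|_] /andP[H1 H2].
  by rewrite distrC.
by move: H2; lra.
Qed.

Lemma network_dist_junction (R : realType) (n : nat) (y : R) (i j : 'I_n) :
  0 <= y -> network_dist (0, i) (y, j) = y.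
Proof.
move=> y0; rewrite /network_dist/=.
by case: ifP; rewrite ?add0r ?sub0r ?normrN ?ger0_norm.
Qed.

Section viscosity.
Context {R : realType} {n : nat} {r lambda : R}.
Context {B : 'I_n -> set R} {O : set 'rV[R]_n} {sigma b h : 'I_n -> R -> R -> R}.
Context {S : 'I_n -> 'rV[R]_n -> R} {h0 : 'rV[R]_n -> R}.
Hypothesis r_gt0 : 0 < r.

Lemma bulk_operator_quadratic (A1 A2 A3 : 'I_n -> R) i x : x \in `[0, r] ->
  bulk_operator r lambda B sigma b h
    (fun j y => A1 j + A2 j * y + A3 j * y ^+ 2) i x =
  lambda * (A1 i + A2 i * x + A3 i * x ^+ 2) +
  sup [set - sigma i x be * (2 * A3 i) + b i x be * (A2 i + 2 * A3 i * x)
           + h i x be | be in B i].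
Proof.
move=> xr; rewrite /bulk_operator.
have qE y : y \in `[0, r] ->
  A1 i + A2 i * y + A3 i * y ^+ 2 = A1 i + A2 i * y + A3 i * y ^+ 2 by [].
by rewrite (derive_on2_quadratic _ _ _ _ _ r_gt0 qE _ xr)
  (derive_on_quadratic _ _ _ _ _ r_gt0 qE _ xr).
Qed.

Lemma junction_operator_quadratic (A1 A2 A3 : 'I_n -> R) :
  junction_operator r O S h0 (fun j y => A1 j + A2 j * y + A3 j * y ^+ 2) =
  inf [set (\sum_(i < n) S i theta * A2 i) + h0 theta | theta in O].
Proof.
have zI : (0 : R) \in `[0, r] by rewrite in_itv/= lexx ltW.
rewrite /junction_operator; congr (inf (_ @` _)); apply/funext => theta.
congr (_ + _); apply: eq_bigr => i _; congr (_ * _).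
rewrite (derive_on_quadratic _ _ (A1 i) (A2 i) (A3 i) r_gt0 _ _ zI)//.
by rewrite mulr0 addr0.
Qed.

(** The same quadratic is placed on all rays, so it is continuous at the junction; a ball of radius
    at most [y] sees only ray [i]. *)
Lemma viscosity_sub_bulk v i y p c e :
  viscosity_sub r lambda B O sigma b h S h0 v -> 0 < y < r -> 0 < e ->
  (forall x, x \in `[0, r] -> `|x - y| < e ->
     v i x <= v i y + p * (x - y) + c / 2 * (x - y) ^+ 2) ->
  lambda * v i y + sup [set - sigma i y be * c + b i y be * p + h i y be
                       | be in B i] <= 0.
Proof.
move=> [_ vsub] /[dup] y0r /andP[y0 yr] e0 vle.
have yI : y \in `[0, r] by rewrite in_itv/= !ltW.
pose A1 (_ : 'I_n) := v i y - p * y + c / 2 * y ^+ 2.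
pose A2 (_ : 'I_n) := p - c * y; pose A3 (_ : 'I_n) := c / 2.
have qE x : A1 i + A2 i * x + A3 i * x ^+ 2 =
    v i y + p * (x - y) + c / 2 * (x - y) ^+ 2 by rewrite /A1 /A2 /A3; field.
have C2 := network_C2_quadratic _ _ _ A1 A2 A3 r_gt0 (fun _ _ => erefl).
have := vsub _ C2 y i yI; rewrite bulk_operator_quadratic// qE subrr mulr0 addr0.
rewrite expr0n mulr0 addr0 subrr /A3 /A2.
rewrite (_ : 2 * (c / 2) = c) ?subrK; last by field.
move=> /(_ _ erefl)[|bulk _]; last exact: bulk.
exists (Num.min e y); first by rewrite lt_min e0.
move=> x j xr; have x0 : 0 <= x by move: xr; rewrite in_itv/= => /andP[].
move=> /(network_dist_interior _ _ _ _ _ _ _ x0)[<- xy].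
rewrite !qE subrr mulr0 expr0n mulr0 !addr0 subrr subr_le0; exact: vle.
Qed.

Lemma viscosity_super_bulk u i y p c e :
  viscosity_super r lambda B O sigma b h S h0 u -> 0 < y < r -> 0 < e ->
  (forall x, x \in `[0, r] -> `|x - y| < e ->
     u i y + p * (x - y) + c / 2 * (x - y) ^+ 2 <= u i x) ->
  0 <= lambda * u i y + sup [set - sigma i y be * c + b i y be * p + h i y be
                            | be in B i].
Proof.
move=> [_ usup] /[dup] y0r /andP[y0 yr] e0 ule.
have yI : y \in `[0, r] by rewrite in_itv/= !ltW.
pose A1 (_ : 'I_n) := u i y - p * y + c / 2 * y ^+ 2.
pose A2 (_ : 'I_n) := p - c * y; pose A3 (_ : 'I_n) := c / 2.
have qE x : A1 i + A2 i * x + A3 i * x ^+ 2 =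
    u i y + p * (x - y) + c / 2 * (x - y) ^+ 2 by rewrite /A1 /A2 /A3; field.
have C2 := network_C2_quadratic _ _ _ A1 A2 A3 r_gt0 (fun _ _ => erefl).
have := usup _ C2 y i yI; rewrite bulk_operator_quadratic// qE subrr mulr0 addr0.
rewrite expr0n mulr0 addr0 subrr /A3 /A2.
rewrite (_ : 2 * (c / 2) = c) ?subrK; last by field.
move=> /(_ _ erefl)[|bulk _]; last exact: bulk.
exists (Num.min e y); first by rewrite lt_min e0.
move=> x j xr; have x0 : 0 <= x by move: xr; rewrite in_itv/= => /andP[].
move=> /(network_dist_interior _ _ _ _ _ _ _ x0)[<- xy].
rewrite !qE subrr mulr0 expr0n mulr0 !addr0 subrr subr_ge0; exact: ule.
Qed.

(** [network_C2] imposes no relation between derivatives at the junction, so quadratics with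
    independent slopes and common value at [0] form a test function. The index [i0] only names the
    junction as [(0, i0)]. *)
Lemma viscosity_sub_junction v (i0 : 'I_n) (p c : 'I_n -> R) e :
  viscosity_sub r lambda B O sigma b h S h0 v -> 0 < e ->
  (forall i x, 0 <= x < e -> v i x <= v i 0 + p i * x + c i * x ^+ 2) ->
  0 <= inf [set (\sum_(i < n) S i theta * p i) + h0 theta | theta in O].
Proof.
move=> [[_ v0] vsub] e0 vle.
have zI : (0 : R) \in `[0, r] by rewrite in_itv/= lexx ltW.
have C2 := network_C2_quadratic _ _ _ (fun i => v i 0) p c r_gt0 v0.
have := vsub _ C2 0 i0 zI; rewrite junction_operator_quadratic//.
rewrite expr0n !mulr0 !addr0 subrr => /(_ _ erefl)[|_ ->//].
exists e => // x j; rewrite in_itv/= => /andP[x0 _].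
rewrite network_dist_junction// => xe.
by rewrite expr0n !mulr0 !addr0 subrr subr_le0 vle// x0.
Qed.

Lemma viscosity_super_junction u (i0 : 'I_n) (p c : 'I_n -> R) e :
  viscosity_super r lambda B O sigma b h S h0 u -> 0 < e ->
  (forall i x, 0 <= x < e -> u i 0 + p i * x + c i * x ^+ 2 <= u i x) ->
  inf [set (\sum_(i < n) S i theta * p i) + h0 theta | theta in O] <= 0.
Proof.
move=> [[_ u0] usup] e0 ule.
have zI : (0 : R) \in `[0, r] by rewrite in_itv/= lexx ltW.
have C2 := network_C2_quadratic _ _ _ (fun i => u i 0) p c r_gt0 u0.
have := usup _ C2 0 i0 zI; rewrite junction_operator_quadratic//.
rewrite expr0n !mulr0 !addr0 subrr => /(_ _ erefl)[|_ ->//].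
exists e => // x j; rewrite in_itv/= => /andP[x0 _].
rewrite network_dist_junction// => xe.
by rewrite expr0n !mulr0 !addr0 subrr subr_ge0 ule// x0.
Qed.

(** Replacing [p] by [q] raises every sum by at least [k]: ray [i0] contributes this much and the
    others contribute nonnegatively. Being uniform in [theta], the gap survives the infimum. *)
Lemma junction_inf_lt (i0 : 'I_n) (p q : 'I_n -> R) :
  O !=set0 -> assumption_S O S ->
  has_lbound [set (\sum_(i < n) S i theta * p i) + h0 theta | theta in O] ->
  (forall i, p i < q i) ->
  inf [set (\sum_(i < n) S i theta * p i) + h0 theta | theta in O] <
  inf [set (\sum_(i < n) S i theta * q i) + h0 theta | theta in O].
Proof.
move=> [t0 Ot0] [zeta zeta0 Sge] lb pq.
pose k := zeta * (q i0 - p i0).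
have k0 : 0 < k by rewrite mulr_gt0// subr_gt0.
apply: (@lt_le_trans _ _ (inf [set (\sum_(i < n) S i theta * p i) + h0 theta
   | theta in O] + k)); first by rewrite ltrDl.
apply: lb_le_inf; first by exists (\sum_(i < n) S i t0 * q i + h0 t0), t0.
move=> _ [t Ot <-].
apply: (@le_trans _ _ (\sum_(i < n) S i t * p i + h0 t + k)).
  by rewrite lerD2r; apply: ge_inf => //; exists t.
rewrite addrAC lerD2r -lerBrDl -sumrB (bigD1 i0)//= -mulrBr.
rewrite -[leLHS]addr0 lerD//.
  by rewrite ler_wpM2r ?Sge// subr_ge0 ltW.
apply: sumr_ge0 => i _; rewrite -mulrBr mulr_ge0// ?subr_ge0 ?(ltW (pq _))//.
exact: le_trans (ltW zeta0) (Sge i t Ot).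
Qed.

End viscosity.

(** * Maximum over the network and conclusion *)

Lemma junction_has_lbound (R : realType) (n : nat) (O : set 'rV[R]_n)
    (S : 'I_n -> 'rV[R]_n -> R) (h0 : 'rV[R]_n -> R) (p : 'I_n -> R) (C D : R) :
  (forall i theta, O theta -> `|S i theta| <= C) ->
  (forall theta, O theta -> `|h0 theta| <= D) ->
  has_lbound [set (\sum_(i < n) S i theta * p i) + h0 theta | theta in O].
Proof.
move=> SC hD; exists (- (\sum_(i < n) C * `|p i| + D)) => _ [t Ot <-].
rewrite lerNl (le_trans (ler_norm _))// normrN (le_trans (ler_normD _ _))//.
rewrite lerD ?hD// (le_trans (ler_norm_sum _ _ _))//.
by apply: ler_sum => i _; rewrite normrM ler_wpM2r// SC.
Qed.

Lemma network_max (R : realType) (n : nat) (r : R) (f : 'I_n -> R -> R) :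
  0 <= r -> (0 < n)%N -> (forall i, {within `[0, r], continuous (f i)}) ->
  exists x0 i0, x0 \in `[0, r] /\
    forall x i, x \in `[0, r] -> f i x <= f i0 x0.
Proof.
move=> r0; case: n f => // n f _ fcont.
have /choice[m mP] i : exists c, c \in `[0, r] /\
    forall t, t \in `[0, r] -> f i t <= f i c.
  by have [c cr cmax] := EVT_max r0 (fcont i); exists c.
pose i0 := [arg max_(i > ord0) f i (m i)]%O.
exists (m i0), i0; split; first exact: (mP i0).1.
move=> x i xr; apply: le_trans ((mP i).2 x xr) _.
by rewrite /i0; case: Order.TotalTheory.arg_maxP => // k _; apply.
Qed.

Theorem theorem2p4 (R : realType) (n : nat) (n_ge1 : (1 <= n)%N)
  (r lambda : R) (r_gt0 : 0 < r) (lambda_gt0 : 0 < lambda)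
  (B : 'I_n -> set R) (O : set 'rV[R]_n)
  (B_neq0 : forall i, B i !=set0) (B_compact : forall i, compact (B i))
  (O_neq0 : O !=set0) (O_compact : compact O)
  (sigma b h : 'I_n -> R -> R -> R)
  (S : 'I_n -> 'rV[R]_n -> R) (h0 : 'rV[R]_n -> R) (chi : 'I_n -> R)
  (sigma_cont : forall i, continuous_on_ray r (B i) (sigma i))
  (b_cont : forall i, continuous_on_ray r (B i) (b i))
  (h_cont : forall i, continuous_on_ray r (B i) (h i))
  (S_cont : forall i, {within O, continuous (S i)})
  (h0_cont : {within O, continuous h0})
  (hS : assumption_S O S)
  (hE : assumption_E r B sigma)
  (hR : assumption_R r B O sigma b h S h0)
  (u v : 'I_n -> R -> R)
  (v_sub : viscosity_sub r lambda B O sigma b h S h0 v)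
  (u_super : viscosity_super r lambda B O sigma b h S h0 u)
  (uv_boundary : forall i, v i r <= u i r) :
  forall (x : R) (i : 'I_n), x \in `[0, r] -> v i x <= u i x.
Proof.
move=> x i xI; rewrite leNgt; apply/negP => uv.
have [s s0 sigma_ge] := hE.
have [cb [ch [cz [cs [[cb0 ch0 cz0 cs0] bnd]]]]] := hR.
pose C := cb + ch + cs.
have C0 : 0 < C by rewrite !addr_gt0.
have bl j : [/\ bounded_lipschitz r C (B j) (sigma j),
    bounded_lipschitz r C (B j) (b j) & bounded_lipschitz r C (B j) (h j)].
  have [Hb Hs Hh _ _] := bnd j.
  split; [apply: (@bounded_lipschitzW _ _ cs)|apply: (@bounded_lipschitzW _ _ cb)|
    apply: (@bounded_lipschitzW _ _ ch)]; try exact: bounded_lipschitz_sup;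
    by rewrite /C; lra.
pose K := hjb_lip lambda C s; pose g := lambda / C.
pose G j := hjb_rhs lambda (B j) (sigma j) (b j) (h j).
have K0 : 0 <= K by exact: hjb_lip_ge0.
have g0 : 0 < g by rewrite divr_gt0.
have Gadm j : admissible r K g (G j).
  by have [bls blb blh] := bl j; apply: admissible_hjb_rhs => //; exact: sigma_ge.
have vpar j : parabola_sub r (G j) (v j).
  move=> y p c e /[dup] yr /andP[y0 y1] e0 vle; have [bls blb blh] := bl j.
  apply: (hjb_rhs_le s0 (B_neq0 j) (sigma_ge j) bls blb blh).
    by rewrite in_itv/= !ltW.
  exact: viscosity_sub_bulk r_gt0 _ _ _ _ _ _ v_sub yr e0 vle.
have upar j : parabola_super r (G j) (u j).
  move=> y p c e /[dup] yr /andP[y0 y1] e0 ule; have [bls blb blh] := bl j.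
  apply: (hjb_rhs_ge lambda_gt0 C0 s0 (B_neq0 j) (sigma_ge j) blb blh).
    by rewrite in_itv/= !ltW.
  exact: viscosity_super_bulk r_gt0 _ _ _ _ _ _ u_super yr e0 ule.
have [[vcont v0E] _] := v_sub; have [[ucont u0E] _] := u_super.
have [|x0 [i0 [x0I wmax]]] :=
    network_max _ _ _ (fun j y => v j y - u j y) (ltW r_gt0) n_ge1.
  by move=> j; apply: within_continuousB.
have {x xI uv} uv0 : u i0 x0 < v i0 x0.
  by rewrite -subr_gt0 (lt_le_trans _ (wmax x i xI))// subr_gt0.
move: x0I; rewrite in_itv/= le_eqVlt => /andP[/predU1P[x00|x00]].
  (* Maximum at the junction: by continuity across the rays, [v - u] is maximal at [0] on each of
     them. *)
  rewrite -x00 in wmax uv0; move=> _.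
  have uv00 j : u j 0 < v j 0 by rewrite (u0E j i0) (v0E j i0).
  have wmaxj j y : y \in `[0, r] -> v j y - u j y <= v j 0 - u j 0.
    by rewrite (u0E j i0) (v0E j i0); exact: wmax.
  have /choice[t tP] j := junction_parabolas _ _ _ _ _ _ _ r_gt0 g0 K0 (Gadm j)
    (vpar j) (upar j) (vcont j) (ucont j) (uv00 j) (wmaxj j).
  (* There are finitely many rays, so their radii have a common positive lower bound. *)
  have [e e0 ed] : exists2 e, 0 < e & forall j, e <= (t j).1.1.1.1.
    near (0 : R)^'+ => e; exists e; first by near: e; exact: nbhs_right_gt.
    near: e; apply: filter_forall => j; apply: nbhs_right_le.
    by have := tP j; case: (t j) => [[[[d p] q] cv] cu] [].
  pose p j := (t j).1.1.1.2; pose q j := (t j).1.1.2.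
  have pq j : p j < q j.
    by have := tP j; rewrite /p /q; case: (t j) => [[[[d p'] q'] cv] cu] [].
  have vle j y : 0 <= y < e -> v j y <= v j 0 + p j * y + (t j).1.2 * y ^+ 2.
    move=> /andP[y0 ye]; have := lt_le_trans ye (ed j); have := tP j; rewrite /p.
    case: (t j) => [[[[d p'] q'] cv] cu] [_ _ H _] /= yd.
    by apply: H; rewrite y0.
  have ule j y : 0 <= y < e -> u j 0 + q j * y + (t j).2 * y ^+ 2 <= u j y.
    move=> /andP[y0 ye]; have := lt_le_trans ye (ed j); have := tP j; rewrite /q.
    case: (t j) => [[[[d p'] q'] cv] cu] [_ _ _ H] /= yd.
    by apply: H; rewrite y0.
  have jv := viscosity_sub_junction r_gt0 _ i0 _ _ _ v_sub e0 vle.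
  have ju := viscosity_super_junction r_gt0 _ i0 _ _ _ u_super e0 ule.
  have lb : has_lbound
      [set (\sum_(j < n) S j theta * p j) + h0 theta | theta in O].
    apply: (@junction_has_lbound _ _ _ _ _ _ cz ch) => [j theta Ot|theta Ot].
      have [_ _ _ Hz _] := bnd j; rewrite -lee_fin (le_trans _ Hz)//.
      by apply: ereal_sup_ubound; exists theta.
    have [_ _ _ _ Hh] := bnd i0; rewrite -lee_fin (le_trans _ Hh)//.
    by apply: ereal_sup_ubound; exists theta.
  (* The infimum with slopes [p] is nonnegative by [jv], the one with the larger slopes [q]
     nonpositive by [ju]. *)
  have := junction_inf_lt i0 _ _ O_neq0 hS lb pq.
  by rewrite ltNge (le_trans ju jv).
rewrite le_eqVlt => /predU1P[x0r|x0r].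
  by move: uv0; rewrite x0r ltNge uv_boundary.
by apply: (no_interior_max _ _ _ _ _ _ _ x0 g0 K0 (Gadm i0) (vpar i0) (upar i0)
  (vcont i0) (ucont i0) _ uv0) => [|y yI]; [rewrite x00|exact: wmax].
Unshelve. all: by end_near. Qed.
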